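(* Let the standing assumptions (see context) hold for $T,m,n,r,F,B,L_F,\varepsilon_r$. There is a constant $h_*>0$, depending only on $m,n,r$ and $L_F$, such that the following holds. Let $0\le s\le h_*$ and $0\le t_0\le T-s$. Let $Y_0=U_0S_0V_0^\top\in\mathbb{R}^{m\times n}$, where $U_0\in\mathbb{R}^{m\times r}$ and $V_0\in\mathbb{R}^{n\times r}$ have orthonormal columns and $S_0\in\mathbb{R}^{r\times r}$ is invertible, and let $A$ solve $$\dot A(\sigma)=F(t_0+\sigma,A(\sigma)),\qquad A(0)=Y_0,\qquad 0\le\sigma\le T-t_0.$$ Let $\Delta A\in\mathbb{R}^{m\times n}$ be a prescribed increment, and let $Y_1$ be the rank-admissible output of the reduced $K$-$L$ step started from $(U_0,S_0,V_0)$ with increment $\Delta A$. Then $$\|Y_1-A(s)\|\le4\,\|Y_0+\Delta A-A(s)\|+5\sqrt{mn}\,\varepsilon_r\,s\,e^{L_Fs}.$$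
   Context: $\|\cdot\|$ is the Frobenius norm. Standing assumptions: $T>0$; $m,n,r$ are integers with $1\le r<\min(m,n)$; $F:[0,T]\times\mathbb{R}^{m\times n}\to\mathbb{R}^{m\times n}$ is continuous, and there are constants $B,L_F$ such that for all $t\in[0,T]$ and $X,Z\in\mathbb{R}^{m\times n}$, $$\|F(t,X)\|\le B,\qquad\|F(t,X)-F(t,Z)\|\le L_F\|X-Z\|;$$ and for some $\varepsilon_r\ge0$, for all $t\in[0,T]$ and every rank-$r$ matrix $Y=USV^\top$ ($U\in\mathbb{R}^{m\times r}$, $V\in\mathbb{R}^{n\times r}$ with orthonormal columns, $S\in\mathbb{R}^{r\times r}$ invertible), $$\|(I-UU^\top)F(t,Y)(I-VV^\top)\|\le\varepsilon_r.$$ Reduced $K$-$L$ step, started from $(U_0,S_0,V_0)$ with increment $\Delta A$ (where $Y_0=U_0S_0V_0^\top$): (1) set $K_1:=U_0S_0+\Delta A\,V_0=(Y_0+\Delta A)V_0$ and compute a factorization $U_1\widehat S_1=K_1$, where $U_1\in\mathbb{R}^{m\times r}$ has orthonormal columns and $\widehat S_1\in\mathbb{R}^{r\times r}$; (2) set $L_1:=V_0S_0^\top U_0^\top U_1+\Delta A^\top U_1=(Y_0+\Delta A)^\top U_1$ and compute a factorization $V_1S_1^\top=L_1$, where $V_1\in\mathbb{R}^{n\times r}$ has orthonormal columns and $S_1\in\mathbb{R}^{r\times r}$. The output is $Y_1:=U_1S_1V_1^\top$. The step (and its output) is called rank-admissible when $\operatorname{rank}K_1=r$. *)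

(* Defs.v *)
From mathcomp Require Import all_boot all_order all_algebra.
From mathcomp Require Import all_classical all_reals all_analysis.
Import Order.TTheory GRing.Theory Num.Theory numFieldNormedType.Exports.

Set Implicit Arguments.
Unset Strict Implicit.
Unset Printing Implicit Defensive.

Local Open Scope classical_set_scope.
Local Open Scope ring_scope.

(* The library norm `|X| on matrices is the maximum of the absolute values of
   the entries, so the Frobenius norm needs its own definition. *)
Definition frob (R : realType) (m n : nat) (X : 'M[R]_(m, n)) : R :=
  Num.sqrt (\sum_(i < m) \sum_(j < n) X i j ^+ 2).

Definition orthonormal_cols (R : realType) (m r : nat) (U : 'M[R]_(m, r)) :
    Prop :=
  U^T *m U = 1%:M.

(* (U, S, V) are factors of the rank-r matrix U S V^T; rank r is automatic. *)
Definition rank_factors (R : realType) (m n r : nat)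
    (U : 'M[R]_(m, r)) (S : 'M[R]_r) (V : 'M[R]_(n, r)) : Prop :=
  [/\ orthonormal_cols U, S \in unitmx & orthonormal_cols V].

(* F is a total function, but only its restriction to [0, T] is constrained. *)
Record standing_assumptions (R : realType) (m n r : nat) (T : R)
    (F : R -> 'M[R]_(m, n) -> 'M[R]_(m, n)) (B LF eps : R) : Prop := {
  sa_T_gt0 : 0 < T;
  sa_r_ge1 : (1 <= r)%N;
  sa_r_lt : (r < minn m n)%N;
  sa_continuous :
    {within [set p : R * 'M[R]_(m, n) | 0 <= p.1 <= T],
      continuous (fun p : R * 'M[R]_(m, n) => F p.1 p.2)};
  sa_bounded : forall t X, 0 <= t <= T -> frob (F t X) <= B;
  sa_lipschitz : forall t X Z, 0 <= t <= T ->
    frob (F t X - F t Z) <= LF * frob (X - Z);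
  sa_eps_ge0 : 0 <= eps;
  sa_normal : forall t (U : 'M[R]_(m, r)) (S : 'M[R]_r) (V : 'M[R]_(n, r)),
    0 <= t <= T -> rank_factors U S V ->
    frob ((1%:M - U *m U^T) *m F t (U *m S *m V^T) *m (1%:M - V *m V^T)) <= eps
}.

(* D is the derivative at x of f restricted to [a, b]; it is one-sided at the
   endpoints. *)
Definition has_derivative_on (R : realType) (m n : nat) (a b : R)
    (f : R -> 'M[R]_(m, n)) (x : R) (D : 'M[R]_(m, n)) : Prop :=
  (y - x)^-1 *: (f y - f x) @[y --> within `[a, b] x^'] --> D.

Definition solves_ivp (R : realType) (m n : nat) (T : R)
    (F : R -> 'M[R]_(m, n) -> 'M[R]_(m, n)) (t0 : R) (Y0 : 'M[R]_(m, n))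
    (A : R -> 'M[R]_(m, n)) : Prop :=
  A 0 = Y0 /\
  forall sigma, 0 <= sigma <= T - t0 ->
    has_derivative_on 0 (T - t0) A sigma (F (t0 + sigma) (A sigma)).

Definition K1 (R : realType) (m n r : nat) (U0 : 'M[R]_(m, r)) (S0 : 'M[R]_r)
    (V0 : 'M[R]_(n, r)) (dA : 'M[R]_(m, n)) : 'M[R]_(m, r) :=
  U0 *m S0 + dA *m V0.

Definition L1 (R : realType) (m n r : nat) (U0 : 'M[R]_(m, r)) (S0 : 'M[R]_r)
    (V0 : 'M[R]_(n, r)) (dA : 'M[R]_(m, n)) (U1 : 'M[R]_(m, r)) :
    'M[R]_(n, r) :=
  V0 *m S0^T *m U0^T *m U1 + dA^T *m U1.

(* A relation, since the two factorizations are not unique. *)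
Definition KL_step (R : realType) (m n r : nat) (U0 : 'M[R]_(m, r))
    (S0 : 'M[R]_r) (V0 : 'M[R]_(n, r)) (dA : 'M[R]_(m, n))
    (U1 : 'M[R]_(m, r)) (S1 : 'M[R]_r) (V1 : 'M[R]_(n, r)) : Prop :=
  [/\ orthonormal_cols U1,
      exists S1hat : 'M[R]_r, U1 *m S1hat = K1 U0 S0 V0 dA,
      orthonormal_cols V1
    & V1 *m S1^T = L1 U0 S0 V0 dA U1].

Definition rank_admissible (R : realType) (m n r : nat) (U0 : 'M[R]_(m, r))
    (S0 : 'M[R]_r) (V0 : 'M[R]_(n, r)) (dA : 'M[R]_(m, n)) : Prop :=
  \rank (K1 U0 S0 V0 dA) = r.

(* Main.v *)
Require Import Defs.
From mathcomp Require Import all_boot all_order all_algebra.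
From mathcomp Require Import all_classical all_reals all_analysis.
From mathcomp Require Import ring lra.
Import Order.TTheory GRing.Theory Num.Theory numFieldNormedType.Exports.
Local Open Scope classical_set_scope.
Local Open Scope ring_scope.

(** Let [Z = Y0 + dA]. The output of the step is [Y1 = U1 U1^T Z], and the range
of [U1] contains that of [K1 = Z V0], so [(1 - U1 U1^T) Z V0 = 0]. The error is
therefore at most [|Z - A s|] plus the size of [(1 - U1 U1^T) Z] on the orthogonal
complement of [V0]. To bound the latter it suffices to know that [A s] is close
to a matrix [K Q^T] with [|Q - V0| <= 1/2]: then [(1 - U1 U1^T) K] is controlled
by [(1 - U1 U1^T) (A s) V0], which is small because [A s] is close to [Z]
([projection_error]).

The real question is why the row space of the solution turns slowly, at a speed
that does not depend on the singular values of [Y0], although the row space of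
a nearly rank-deficient matrix is very sensitive to perturbations. The reason
is that the normal bound holds at every rank-r matrix, and by continuity at
those of smaller rank ([normal_bound_diag]). Let [X] have singular triples
[(u_i, d_i, v_i)]. Deleting the [i]-th triple moves [X] by [d_i], and the matrix
so obtained admits a column frame in which [u_i] is replaced by a vector
orthogonal to all [u_j]; for that frame [u_i] is a normal direction. Hence
[u_i^T F(X) (1 - V V^T)] is at most [L d_i] up to [eps], and dividing by [d_i]
gives [F(X) = H V^T + X N + E] with [|N| <= sqrt r L] and
[|E| <= (1 + sqrt r) eps] ([tangent_decomposition_svd], [local_decomposition]).

In an Euler step of length [h] for [X = K Q^T] the three parts become an update
of [K], the update [Q + h N^T Q], and an error ([euler_step]). Only [K] can
change wildly; [Q] drifts from [V0] at bounded speed. Instead of a uniform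
partition, the steps are chained by real induction along a gauge given by the
pointwise derivative of [A] ([gauge_induction]), which yields the factored
approximation with error [((1 + sqrt r) eps + del) s exp(L s)] for every
positive [del] ([near_low_rank]). Finally [1 + sqrt r <= sqrt (m n)] because
[r < min m n]. The singular value decomposition is obtained over the reals by
maximising Rayleigh quotients. *)

Set Implicit Arguments.
Unset Strict Implicit.
Unset Printing Implicit Defensive.

(** * The Frobenius norm *)

Section Frobenius.
Variable R : realType.

Lemma frob_sqr m n (X : 'M[R]_(m, n)) :
  frob X ^+ 2 = \sum_i \sum_j X i j ^+ 2.
Proof.
rewrite sqr_sqrtr //; apply: sumr_ge0 => i _; apply: sumr_ge0 => j _.
exact: sqr_ge0.
Qed.

Lemma frob_sqr_tr m n (X : 'M[R]_(m, n)) : frob X ^+ 2 = \tr (X^T *m X).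
Proof.
rewrite frob_sqr exchange_big; apply: eq_bigr => j _; rewrite !mxE.
by apply: eq_bigr => i _; rewrite !mxE expr2.
Qed.

Lemma frob_ge0 m n (X : 'M[R]_(m, n)) : 0 <= frob X.
Proof. exact: sqrtr_ge0. Qed.

Lemma frob_le m n p q (X : 'M[R]_(m, n)) (Y : 'M[R]_(p, q)) :
  frob X ^+ 2 <= frob Y ^+ 2 -> frob X <= frob Y.
Proof. by rewrite ler_pXn2r // ?nnegrE ?frob_ge0. Qed.

Lemma frob_eq m n p q (X : 'M[R]_(m, n)) (Y : 'M[R]_(p, q)) :
  frob X ^+ 2 = frob Y ^+ 2 -> frob X = frob Y.
Proof. by move=> e; apply/eqP; rewrite eq_le !frob_le ?e. Qed.

Lemma frob_tr m n (X : 'M[R]_(m, n)) : frob X^T = frob X.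
Proof. by apply: frob_eq; rewrite !frob_sqr_tr trmxK mxtrace_mulC. Qed.

Lemma trmxZ m n (a : R) (X : 'M[R]_(m, n)) : (a *: X)^T = a *: X^T.
Proof. by apply/matrixP => i j; rewrite !mxE. Qed.

Lemma frobZ m n (a : R) (X : 'M[R]_(m, n)) : frob (a *: X) = `|a| * frob X.
Proof.
apply/eqP; rewrite -(@eqrXn2 _ 2) ?mulr_ge0 ?frob_ge0 //; apply/eqP.
rewrite exprMn real_normK ?num_real // !frob_sqr_tr trmxZ.
by rewrite -scalemxAl -scalemxAr scalerA mxtraceZ.
Qed.

Lemma frobN m n (X : 'M[R]_(m, n)) : frob (- X) = frob X.
Proof. by rewrite -scaleN1r frobZ normrN1 mul1r. Qed.

Lemma frobC m n (X Y : 'M[R]_(m, n)) : frob (X - Y) = frob (Y - X).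
Proof. by rewrite -frobN opprB. Qed.

Lemma frob0 m n : frob (0 : 'M[R]_(m, n)) = 0.
Proof. by rewrite -(scale0r 0) frobZ normr0 mul0r. Qed.

Lemma frob_eq0 m n (X : 'M[R]_(m, n)) : frob X = 0 -> X = 0.
Proof.
move=> X0; have := frob_sqr X; rewrite X0 expr0n /= => /esym.
move=> /(psumr_eq0P (fun i _ => sumr_ge0 _ (fun j _ => sqr_ge0 (X i j)))) H.
apply/matrixP => i j; rewrite mxE; apply/eqP; rewrite -sqrf_eq0; apply/eqP.
exact: (psumr_eq0P (fun j _ => sqr_ge0 (X i j)) (H i isT)).
Qed.

Lemma tr_trmx_mul m n (X Y : 'M[R]_(m, n)) : \tr (Y^T *m X) = \tr (X^T *m Y).
Proof. by rewrite -mxtrace_tr trmx_mul trmxK. Qed.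

Lemma frobD_sqr m n (X Y : 'M[R]_(m, n)) :
  frob (X + Y) ^+ 2 = frob X ^+ 2 + 2 * \tr (X^T *m Y) + frob Y ^+ 2.
Proof.
rewrite !frob_sqr_tr [(X + Y)^T]linearD /= mulmxDl !mulmxDr !mxtraceD (tr_trmx_mul X Y).
ring.
Qed.

(** Cauchy-Schwarz for the trace inner product: expand the square of
[|Y|^2 X - <X, Y> Y]. *)
Lemma tr_le_frob m n (X Y : 'M[R]_(m, n)) :
  \tr (X^T *m Y) ^+ 2 <= frob X ^+ 2 * frob Y ^+ 2.
Proof.
have [Y0|Y0] := eqVneq (frob Y) 0.
  by rewrite (frob_eq0 Y0) mulmx0 mxtrace0 frob0 expr0n /= mulr0.
have Yp : 0 < frob Y ^+ 2 by rewrite exprn_gt0 // lt_def Y0 frob_ge0.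
set t := \tr _.
have := sqr_ge0 (frob (frob Y ^+ 2 *: X + (- t) *: Y)).
rewrite frobD_sqr !frobZ !exprMn !real_normK ?num_real // trmxZ.
rewrite -scalemxAl -scalemxAr scalerA mxtraceZ -/t => H.
have {}H : 0 <= frob Y ^+ 2 * (frob X ^+ 2 * frob Y ^+ 2 - t ^+ 2).
  by apply: le_trans H _; lra.
by move: H; rewrite pmulr_rge0 // subr_ge0.
Qed.

Lemma ler_frobD m n (X Y : 'M[R]_(m, n)) : frob (X + Y) <= frob X + frob Y.
Proof.
have h := addr_ge0 (frob_ge0 X) (frob_ge0 Y).
rewrite -(@ler_pXn2r _ 2) // ?nnegrE ?frob_ge0 // frobD_sqr sqrrD.
rewrite lerD2r lerD2l -[leRHS]mulr_natl ler_pM2l //.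
apply: le_trans (ler_norm _) _.
rewrite -(@ler_pXn2r _ 2) // ?nnegrE ?mulr_ge0 ?frob_ge0 //.
by rewrite real_normK ?num_real // exprMn tr_le_frob.
Qed.

Lemma ler_frobM m n p (X : 'M[R]_(m, n)) (Y : 'M[R]_(n, p)) :
  frob (X *m Y) <= frob X * frob Y.
Proof.
rewrite -(@ler_pXn2r _ 2) // ?nnegrE ?mulr_ge0 ?frob_ge0 // exprMn.
rewrite [X in X <= _]frob_sqr [frob X ^+ 2]frob_sqr -[frob Y]frob_tr.
rewrite [frob Y^T ^+ 2]frob_sqr mulr_suml; apply: ler_sum => i _.
rewrite mulr_sumr; apply: ler_sum => j _.
have := tr_le_frob (row i X)^T (col j Y).
rewrite trmxK trace_mx11 => H.
apply: le_trans (le_trans _ H) _.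
  by rewrite !mxE; under [in X in _ <= X]eq_bigr do rewrite !mxE.
rewrite frob_tr -[frob (col _ _)]frob_tr !frob_sqr !big_ord1.
by under eq_bigr do rewrite mxE; under [X in _ * X]eq_bigr do rewrite !mxE;
  under [X in _ <= _ * X]eq_bigr do rewrite !mxE.
Qed.

Lemma trmx_compl n r (V : 'M[R]_(n, r)) :
  (1%:M - V *m V^T)^T = 1%:M - V *m V^T.
Proof. by rewrite linearB /= trmx1 trmx_mul trmxK. Qed.

Lemma compl_idem n r (V : 'M[R]_(n, r)) : orthonormal_cols V ->
  (1%:M - V *m V^T) *m (1%:M - V *m V^T) = 1%:M - V *m V^T.
Proof.
move=> VV; rewrite mulmxBr mulmx1 mulmxBl mul1mx mulmxA -(mulmxA V V^T V) VV.
by rewrite mulmx1 subrr subr0.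
Qed.

(** Pythagoras for the orthogonal splitting along the range of [V]. *)
Lemma frob_pythagoras n r p (V : 'M[R]_(n, r)) (X : 'M[R]_(n, p)) :
  orthonormal_cols V ->
  frob (V^T *m X) ^+ 2 + frob ((1%:M - V *m V^T) *m X) ^+ 2 = frob X ^+ 2.
Proof.
move=> VV; rewrite !frob_sqr_tr -mxtraceD; congr (\tr _).
rewrite !trmx_mul trmx_compl trmxK -mulmxA [in X in _ + X]mulmxA.
rewrite -(mulmxA X^T (1%:M - _)) compl_idem // -(mulmxA X^T) -mulmxDr; congr (_ *m _).
by rewrite mulmxBl mul1mx mulmxA addrC subrK.
Qed.

Lemma frob_orthol m r n (U : 'M[R]_(m, r)) (X : 'M[R]_(r, n)) :
  orthonormal_cols U -> frob (U *m X) = frob X.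
Proof.
move=> UU; apply: frob_eq.
by rewrite !frob_sqr_tr trmx_mul mulmxA -(mulmxA X^T) UU mulmx1.
Qed.

Lemma frob_orthor m r n (V : 'M[R]_(n, r)) (X : 'M[R]_(m, r)) :
  orthonormal_cols V -> frob (X *m V^T) = frob X.
Proof. by move=> VV; rewrite -frob_tr trmx_mul trmxK frob_orthol ?frob_tr. Qed.

Lemma frob_trmull n r p (V : 'M[R]_(n, r)) (X : 'M[R]_(n, p)) :
  orthonormal_cols V -> frob (V^T *m X) <= frob X.
Proof.
by move=> VV; apply: frob_le; rewrite -(frob_pythagoras X VV) lerDl sqr_ge0.
Qed.

Lemma frob_compll n r p (V : 'M[R]_(n, r)) (X : 'M[R]_(n, p)) :
  orthonormal_cols V -> frob ((1%:M - V *m V^T) *m X) <= frob X.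
Proof.
by move=> VV; apply: frob_le; rewrite -(frob_pythagoras X VV) lerDr sqr_ge0.
Qed.

Lemma frob_mulr n r p (V : 'M[R]_(n, r)) (X : 'M[R]_(p, n)) :
  orthonormal_cols V -> frob (X *m V) <= frob X.
Proof. by move=> VV; rewrite -frob_tr trmx_mul -(frob_tr X) frob_trmull. Qed.

Lemma frob_complr n r p (V : 'M[R]_(n, r)) (X : 'M[R]_(p, n)) :
  orthonormal_cols V -> frob (X *m (1%:M - V *m V^T)) <= frob X.
Proof.
by move=> VV; rewrite -frob_tr trmx_mul trmx_compl -(frob_tr X) frob_compll.
Qed.

Lemma frob_orthonormal n r (V : 'M[R]_(n, r)) :
  orthonormal_cols V -> frob V ^+ 2 = r%:R.
Proof. by move=> VV; rewrite frob_sqr_tr VV mxtrace1. Qed.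

Lemma frob_rows_le m n (c : R) (X : 'M[R]_(m, n)) : 0 <= c ->
  (forall i, frob (row i X) <= c) -> frob X <= Num.sqrt m%:R * c.
Proof.
move=> c0 H; rewrite -(@ler_pXn2r _ 2) // ?nnegrE ?mulr_ge0 ?frob_ge0 //.
rewrite exprMn (sqr_sqrtr (ler0n R m)) frob_sqr.
rewrite -[m in m%:R]card_ord mulr_natl -sumr_const; apply: ler_sum => i _.
have : frob (row i X) ^+ 2 <= c ^+ 2 by rewrite ler_pXn2r ?nnegrE ?frob_ge0.
by rewrite frob_sqr big_ord1; under eq_bigr do rewrite mxE.
Qed.

Lemma frob_entries_le m n (c : R) (X : 'M[R]_(m, n)) : 0 <= c ->
  (forall i j, `|X i j| <= c) -> frob X <= Num.sqrt m%:R * (Num.sqrt n%:R * c).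
Proof.
move=> c0 H; apply: frob_rows_le => [|i]; first by rewrite mulr_ge0.
rewrite -frob_tr; apply: frob_rows_le => // j.
rewrite -(@ler_pXn2r _ 2) // ?nnegrE ?frob_ge0 // frob_sqr !big_ord1 !mxE.
by rewrite -[X i j ^+ 2]real_normK ?num_real // ler_pXn2r ?nnegrE //.
Qed.
End Frobenius.

(** * Singular value decomposition of a real matrix *)

Section Spectral.
Variable R : realType.

Lemma unit_kernel p q (B : 'M[R]_(p, q)) : (\rank B < p)%N ->
  exists2 u : 'rV[R]_p, u *m B = 0 & u *m u^T = 1%:M.
Proof.
move=> rB; have : kermx B != 0 by rewrite kermx_eq0 /row_free neq_ltn rB.
move=> /rowV0Pn[v /sub_kermxP vB v0]; exists ((frob v)^-1 *: v).
  by rewrite -scalemxAl vB scaler0.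
have fv : frob v != 0 by apply: contra_neq v0 => /frob_eq0.
rewrite trmxZ -scalemxAl -scalemxAr scalerA [v *m _]mx11_scalar.
have -> : (v *m v^T) 0 0 = frob v ^+ 2.
  by rewrite -trace_mx11 -frob_tr frob_sqr_tr trmxK.
by rewrite -mul_scalar_mx -scalar_mxM -expr2 -exprMn mulVf ?expr1n.
Qed.

Definition quadratic_form n (M : 'M[R]_n) (x : 'rV[R]_n) : R :=
  \tr (x *m M *m x^T).

Lemma continuous_sumr (T : topologicalType) (I : Type) (s : seq I)
    (f : I -> T -> R) :
  (forall i, continuous (f i)) -> continuous (fun x => \sum_(i <- s) f i x).
Proof.
move=> cf; elim: s => [|i s IH].
  by under eq_fun do rewrite big_nil; move=> x; exact: cst_continuous.
under eq_fun do rewrite big_cons.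
by move=> x; apply: continuousD; [exact: cf|exact: IH].
Qed.

Lemma continuous_quadratic_form n (M : 'M[R]_n) : continuous (quadratic_form M).
Proof.
rewrite /quadratic_form; have -> : (fun x : 'rV[R]_n => \tr (x *m M *m x^T)) =
    (fun x => \sum_j \sum_i x 0 i * M i j * x 0 j).
  apply/funext => x; rewrite trace_mx11 !mxE; apply: eq_bigr => j _.
  by rewrite !mxE mulr_suml.
apply: continuous_sumr => j; apply: continuous_sumr => i x.
have c k : continuous (fun y : 'rV[R]_n => y 0 k) by exact: coord_continuous.
exact: (cvgM (cvgMr_tmp (c i x)) (c j x)).
Qed.

Lemma quadratic_formD n (M : 'M[R]_n) (x y : 'rV[R]_n) (a : R) : M^T = M ->
  quadratic_form M (x + a *: y) = quadratic_form M x
    + 2 * a * \tr (x *m M *m y^T) + a ^+ 2 * quadratic_form M y.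
Proof.
move=> sM; rewrite /quadratic_form [(x + a *: y)^T]linearD /= trmxZ !mulmxDl !mulmxDr.
rewrite -!scalemxAl -!scalemxAr !mxtraceD !mxtraceZ.
have -> : \tr (y *m M *m x^T) = \tr (x *m M *m y^T).
  by rewrite -mxtrace_tr !trmx_mul trmxK sM mulmxA.
ring.
Qed.

Lemma quadratic_form1 n (x : 'rV[R]_n) : quadratic_form 1%:M x = frob x ^+ 2.
Proof. by rewrite /quadratic_form mulmx1 -(frob_tr x) frob_sqr_tr trmxK. Qed.

Lemma frob_row_unit n (x : 'rV[R]_n) : (x *m x^T == 1%:M) = (frob x ^+ 2 == 1).
Proof.
rewrite -(frob_tr x) frob_sqr_tr trmxK [x *m _]mx11_scalar trace_mx11.
set c := (x *m x^T) 0 0; rewrite [c%:M 0 0]mxE eqxx mulr1n.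
apply/eqP/eqP => [H|-> //].
by have := congr1 (fun A : 'M[R]_1 => A 0 0) H; rewrite !(mxE, eqxx).
Qed.

(** A maximiser of the Rayleigh quotient on a sphere of the orthogonal
complement of the rows of [W] is [M]-orthogonal to everything that is
orthogonal to it there, because the first variation vanishes. *)
Lemma rayleigh_maximizer k n (M : 'M[R]_n) (W : 'M[R]_(k, n)) :
  M^T = M -> (k < n)%N ->
  exists x : 'rV[R]_n, [/\ x *m W^T = 0, x *m x^T = 1%:M &
    forall y : 'rV[R]_n, y *m W^T = 0 -> y *m x^T = 0 -> x *m M *m y^T = 0].
Proof.
move=> sM kn.
pose A := [set x : 'rV[R]_n | quadratic_form (W^T *m W) x = 0]
  `&` [set x | quadratic_form 1%:M x = 1].
have AE x : A x <-> x *m W^T = 0 /\ frob x ^+ 2 = 1.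
  rewrite /A /setI /= quadratic_form1.
  have -> : quadratic_form (W^T *m W) x = frob (x *m W^T) ^+ 2.
    rewrite -frob_tr frob_sqr_tr trmxK /quadratic_form; congr (\tr _).
    by rewrite trmx_mul trmxK !mulmxA.
  split=> [[/eqP + ->]|[-> ->]]; last by rewrite frob0 expr0n.
  by rewrite sqrf_eq0 => /eqP/frob_eq0.
have A0 : A !=set0.
  have [|u uW uu] := @unit_kernel _ _ W^T.
    by apply: leq_ltn_trans kn; exact: rank_leq_col.
  exists u; apply/AE; split=> //; apply/eqP; rewrite -frob_row_unit; exact/eqP.
have cA : compact A.
  apply: bounded_closed_compact; last first.
    by apply: closedI; apply: preimage_closed (@closed_eq _ _) => ? _;
      exact: continuous_quadratic_form.
  exists 1; split; first exact: num_real.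
  move=> b b1 x /AE[_ /eqP]; rewrite sqrf_eq1 => /orP[|] /eqP fx; last first.
    by have := frob_ge0 x; rewrite fx ler0N1.
  apply: le_trans (ltW b1); rewrite {1}/Num.norm /= mx_normrE.
  apply/bigmax_leP; split=> // -[i j] _ /=.
  rewrite -fx -sqrtr_sqr ler_wsqrtr // (bigD1 i) //= (bigD1 j) //= -addrA lerDl.
  rewrite addr_ge0 ?sumr_ge0 // => [? _|? _]; first exact: sqr_ge0.
  by apply: sumr_ge0 => ? _; exact: sqr_ge0.
have [|x] := @EVT_max_rV R n (quadratic_form M) A A0 cA.
  by apply: continuous_subspaceT; exact: continuous_quadratic_form.
rewrite inE => /AE[xW x1] xmax; exists x; split=> //.
  by apply/eqP; rewrite frob_row_unit x1.
move=> y yW yx.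
(* By homogeneity, maximality extends from the sphere to the whole subspace. *)
have scaled z : z *m W^T = 0 -> quadratic_form M z <= quadratic_form M x * frob z ^+ 2.
  move=> zW; have [z0|z0] := eqVneq (frob z) 0.
    by rewrite z0 (frob_eq0 z0) /quadratic_form !mul0mx mxtrace0 expr0n /= mulr0.
  have : quadratic_form M ((frob z)^-1 *: z) <= quadratic_form M x.
    apply: xmax; rewrite inE; apply/AE; rewrite -scalemxAl zW scaler0.
    by rewrite frobZ exprMn real_normK ?num_real // -exprMn mulVf // expr1n.
  rewrite {1}/quadratic_form trmxZ -!scalemxAl -scalemxAr !mxtraceZ mulrA -expr2 exprVn.
  rewrite ler_pdivrMl 1?mulrC // exprn_gt0 // lt_def z0; exact: frob_ge0.
set b := \tr (x *m M *m y^T).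
(* First variation in the direction [y]. *)
have var (a : R) : 2 * a * b <=
    a ^+ 2 * (quadratic_form M x * frob y ^+ 2 - quadratic_form M y).
  have := scaled (x + a *: y).
  rewrite mulmxDl -scalemxAl xW yW scaler0 addr0 => /(_ erefl).
  rewrite quadratic_formD // -/b frobD_sqr x1 frobZ exprMn real_normK ?num_real //.
  have -> : \tr (x^T *m (a *: y)) = 0.
    by rewrite -scalemxAr mxtraceZ mxtrace_mulC yx mxtrace0 mulr0.
  lra.
suff b0 : b = 0 by rewrite [LHS]mx11_scalar -trace_mx11 -/b b0 raddf0.
set c := quadratic_form M x * frob y ^+ 2 - quadratic_form M y in var.
(* A parabola through the origin that stays nonnegative has zero slope. *)
have [d0 cd] : 0 < 1 + `|c| /\ c < 1 + `|c|.
  by rewrite ltr_wpDr // ltr_pwDl // ler_norm.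
move: (1 + `|c|) d0 cd => d d0 cd.
have H : 0 <= b ^+ 2 * (c - 2 * d).
  have := var (b / d); rewrite -(ler_pM2r (exprn_gt0 2 d0)) -subr_ge0.
  by congr (0 <= _); field; rewrite gt_eqF.
apply/eqP; rewrite -sqrf_eq0 eq_le sqr_ge0 andbT.
by move: H; rewrite nmulr_lge0 //; lra.
Qed.

(** The rows of [W] are built one Rayleigh maximiser at a time. The last
clause, invariance of the orthogonal complement under [M], is what makes the
next maximiser [M]-orthogonal to the previous rows. *)
Lemma partial_diagonalization k n (M : 'M[R]_n) : M^T = M -> (k <= n)%N ->
  exists W : 'M[R]_(k, n), [/\ W *m W^T = 1%:M, is_diag_mx (W *m M *m W^T) &
    forall y : 'rV[R]_n, y *m W^T = 0 -> y *m M *m W^T = 0].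
Proof.
move=> sM; elim: k => [_|k IH kn].
  exists 0; split; first by rewrite [LHS]flatmx0 [RHS]flatmx0.
    by rewrite !mul0mx mx0_is_diag.
  by move=> y _; rewrite trmx0 mulmx0.
have [W [WW dW iW]] := IH (ltnW kn).
have [x [xW xx xmax]] := rayleigh_maximizer W sM kn.
have Wx : W *m x^T = 0 by rewrite -[LHS]trmxK trmx_mul trmxK xW trmx0.
rewrite -[k.+1]/(1 + k)%N; exists (col_mx x W); rewrite tr_col_mx; split.
- by rewrite mul_col_row WW xx xW Wx -scalar_mx_block.
- rewrite mul_col_mx mul_col_row is_diag_block_mx // iW // dW mx11_is_diag.
  by rewrite eqxx /= andbT -trmx_eq0 !trmx_mul trmxK sM mulmxA iW.
move=> y; rewrite !mul_mx_row => H.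
have [yx yW] := eq_row_mx (etrans H (esym (row_mx0 _ _ _ _))).
rewrite iW // -[RHS]row_mx0; congr row_mx.
by apply: trmx_inj; rewrite trmx0 !trmx_mul trmxK sM mulmxA xmax.
Qed.

(** Zero columns are replaced by unit vectors of the left kernel of [C], which
is nontrivial as long as a zero column remains because [r <= m]; the 0-1 row
[b] switches the new columns off again. *)
Lemma fill_zero_columns m r (C : 'M[R]_(m, r)) : (r <= m)%N ->
  is_diag_mx (C^T *m C) ->
  exists (C' : 'M[R]_(m, r)) (b : 'rV[R]_r),
  [/\ C = C' *m diag_mx b, is_diag_mx (C'^T *m C') &
      forall i, col i C' != 0].
Proof.
move=> rm; have [k] := ubnP #|[pred i | col i C == 0]|.
elim: k C => // k IH C; rewrite ltnS => Ck dC.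
have [i /eqP Ci|noC] := pickP [pred i | col i C == 0]; last first.
  exists C, (const_mx 1); split=> // [|i]; last first.
    by rewrite -[_ == 0]/([pred i | col i C == 0] i) noC.
  by apply/matrixP => a j; rewrite mul_mx_diag !mxE mulr1.
have rC : (\rank C < m)%N.
  apply: leq_trans rm; rewrite ltn_neqAle rank_leq_col andbT.
  apply/negP => rC; have fC : row_free C^T by rewrite /row_free mxrank_tr.
  have : delta_mx 0 i *m C^T = (0 : 'rV[R]_r) *m C^T.
    by rewrite -trmx_delta -trmx_mul -colE Ci trmx0 mul0mx.
  move=> /(row_free_inj fC) /matrixP/(_ 0 i); rewrite !mxE !eqxx.
  by move/eqP; rewrite oner_eq0.
have [u uC uu] := unit_kernel rC.
have Cu : C^T *m u^T = 0 by rewrite -trmx_mul uC trmx0.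
have Cia a : C a i = 0 by have /matrixP/(_ a 0) := Ci; rewrite !mxE.
pose C2 := C + u^T *m delta_mx 0 i.
have C2E a j : C2 a j = C a j + u 0 a * (j == i)%:R.
  by rewrite !mxE big_ord1 !mxE.
have colC2 j : j != i -> col j C2 = col j C.
  move=> ji; apply/matrixP => a z; rewrite ![col j _ _ _]mxE C2E.
  by rewrite (negbTE ji) mulr0 addr0.
have colC2i : col i C2 != 0.
  apply/eqP => H; have : u = 0.
    apply/matrixP => z a; rewrite ord1; have /matrixP/(_ a 0) := H.
    by rewrite [col i _ _ _]mxE C2E Cia eqxx mulr1 add0r !mxE.
  move=> u0; move: uu; rewrite u0 mul0mx => /matrixP/(_ 0 0)/eqP.
  by rewrite !mxE eq_sym oner_eq0.
have dC2 : is_diag_mx (C2^T *m C2).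
  have -> : C2^T *m C2 = C^T *m C + delta_mx i i.
    rewrite /C2 [(_ + _)^T]linearD /= mulmxDl !mulmxDr trmx_mul trmxK trmx_delta.
    rewrite -!mulmxA (mulmxA u) uu uC (mulmxA C^T) Cu mulmx0 mul0mx addr0 add0r.
    by rewrite mul1mx mul_delta_mx.
  apply/is_diag_mxP => a c ac; have /is_diag_mxP/(_ a c ac) Cac := dC.
  rewrite [LHS]mxE Cac mxE add0r.
  case: andP => // -[/eqP ai /eqP ci].
  by rewrite ai ci eqxx in ac.
have [|C' [b [C2b dC' C'0]]] := IH C2 _ dC2.
  apply: leq_trans Ck; apply: proper_card; apply/properP; split.
    apply/fintype.subsetP => j; rewrite !inE; have [->|ji] := eqVneq j i.
      by rewrite (negbTE colC2i).
    by rewrite colC2.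
  by exists i; rewrite !inE ?Ci // (negbTE colC2i).
exists C', (\row_j (b 0 j * (j != i)%:R)); split=> //.
apply/matrixP => a j; rewrite mul_mx_diag !mxE mulrA.
have /matrixP/(_ a j) := C2b; rewrite C2E mul_mx_diag !mxE => <-.
have [->|_] := eqVneq j i; first by rewrite Cia mulr0.
by rewrite mulr0 mulr1 addr0.
Qed.

(** Singular value decomposition: diagonalise [K^T K], so that [K O] has
orthogonal columns, and normalise these. *)
Lemma svd m r (K : 'M[R]_(m, r)) : (r <= m)%N ->
  exists (U : 'M[R]_(m, r)) (d : 'rV[R]_r) (O : 'M[R]_r),
  [/\ orthonormal_cols U, orthonormal_cols O & K = U *m diag_mx d *m O^T].
Proof.
move=> rm; have [|W [WW dW _]] := @partial_diagonalization r r (K^T *m K) _ (leqnn r).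
  by rewrite trmx_mul trmxK.
have WtW := mulmx1C WW.
have dC : is_diag_mx ((K *m W^T)^T *m (K *m W^T)).
  by rewrite trmx_mul trmxK !mulmxA; rewrite !mulmxA in dW.
have [C [b [KC dC' C0]]] := fill_zero_columns rm dC.
pose c i := frob (col i C).
have c0 i : c i != 0 by apply: contra_neq (C0 i) => /frob_eq0.
exists (C *m diag_mx (\row_i (c i)^-1)), (\row_i (c i * b 0 i)), W^T.
split; last 2 first.
- by rewrite /orthonormal_cols trmxK.
- rewrite -(mulmxA C) mulmx_diag (_ : \row__ _ = b); last first.
    by apply/rowP => i; rewrite !mxE mulrA mulVf ?mul1r.
  by rewrite -KC trmxK -mulmxA WtW mulmx1.
rewrite /orthonormal_cols trmx_mul tr_diag_mx -!mulmxA (mulmxA C^T).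
apply/matrixP => i j; rewrite mul_diag_mx mxE mul_mx_diag !mxE.
have [->|ij] := eqVneq i j; last first.
  by have /is_diag_mxP/(_ i j ij) := dC'; rewrite mxE => ->; rewrite mul0r mulr0.
have -> : \sum_a C^T j a * C a j = c j ^+ 2.
  rewrite frob_sqr; apply: eq_bigr => a _.
  by rewrite big_ord1 !mxE expr2.
by rewrite expr2 mulfK // mulVf.
Qed.
End Spectral.

(** * Splitting the vector field along the rows of a low-rank matrix *)

Section LocalDecomposition.
Variables (R : realType) (m n r : nat) (G : 'M[R]_(m, n) -> 'M[R]_(m, n)).
Variables (L eps : R).
Hypothesis Llip : forall X Z, frob (G X - G Z) <= L * frob (X - Z).
Hypothesis Gnormal : forall (U : 'M[R]_(m, r)) (S : 'M[R]_r) (V : 'M[R]_(n, r)),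
  rank_factors U S V ->
  frob ((1%:M - U *m U^T) *m G (U *m S *m V^T) *m (1%:M - V *m V^T)) <= eps.

(** The normal bound survives for a singular middle factor: fill the zeros of
[d] with a small [a] to get an invertible one, and let [a] tend to zero using
the Lipschitz bound. *)
Lemma normal_bound_diag (U : 'M[R]_(m, r)) (d : 'rV[R]_r) (V : 'M[R]_(n, r)) :
  orthonormal_cols U -> orthonormal_cols V ->
  frob ((1%:M - U *m U^T) *m G (U *m diag_mx d *m V^T) *m (1%:M - V *m V^T))
    <= eps.
Proof.
move=> UU VV; apply/ler_addgt0Pr => e e0.
pose z : 'rV[R]_r := \row_i (d 0 i == 0)%:R.
pose k := frob (diag_mx z).
have k0 : 0 < `|L| * k + 1 by rewrite ltr_wpDl // mulr_ge0 ?frob_ge0.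
pose a := e / (`|L| * k + 1).
have a0 : 0 < a by rewrite divr_gt0.
pose d' := d + a *: z.
have uS : diag_mx d' \in unitmx.
  rewrite unitmxE det_diag unitfE; apply/prodf_neq0 => i _; rewrite !mxE.
  have [->|di] := eqVneq (d 0 i) 0; first by rewrite add0r mulr1 gt_eqF.
  by rewrite mulr0 addr0.
set P := 1%:M - U *m U^T; set Q := 1%:M - V *m V^T.
set X := U *m diag_mx d *m V^T; set X' := U *m diag_mx d' *m V^T.
have XX' : frob (X - X') = a * k.
  rewrite frobC -mulmxBl -mulmxBr -raddfB /= /d' [d + _]addrC addrK linearZ /=.
  by rewrite frob_orthor // frob_orthol // frobZ gtr0_norm.
have -> : P *m G X *m Q = P *m G X' *m Q + P *m (G X - G X') *m Q.
  by rewrite -mulmxDl -mulmxDr addrC subrK.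
apply: le_trans (ler_frobD _ _) _; apply: lerD; first exact: Gnormal.
apply: le_trans (frob_complr _ VV) _; apply: le_trans (frob_compll _ UU) _.
apply: le_trans (Llip _ _) _; rewrite XX' mulrCA.
have ak : a * (`|L| * k + 1) = e by rewrite divfK // gt_eqF.
rewrite -ak ler_pM2l // (le_trans (ler_wpM2r (frob_ge0 _) (ler_norm L))) //.
by rewrite lerDl.
Qed.

Lemma frob_row_le p q (X : 'M[R]_(p, q)) i : frob (row i X) <= frob X.
Proof.
apply: frob_le; rewrite !frob_sqr big_ord1 (bigD1 i) //=.
under eq_bigr do rewrite mxE.
by rewrite lerDl sumr_ge0 // => ? _; apply: sumr_ge0 => ? _; exact: sqr_ge0.
Qed.

(** Exchanging the [i]-th column of [U] for a unit vector [u] orthogonal to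
all of [U] gives another admissible frame for [U diag(d) V^T] with [d_i] set
to zero, and this frame is orthogonal to the old [i]-th column. *)
Lemma exchange_column (U : 'M[R]_(m, r)) (u : 'rV[R]_m) (i : 'I_r)
    (d : 'rV[R]_r) :
  orthonormal_cols U -> u *m U = 0 -> u *m u^T = 1%:M -> d 0 i = 0 ->
  exists W : 'M[R]_(m, r),
  [/\ orthonormal_cols W, row i U^T *m W = 0 &
      U *m diag_mx d = W *m diag_mx d].
Proof.
move=> UU uU uu di; pose P := diag_mx (\row_j (j != i)%:R : 'rV[R]_r).
pose e := delta_mx 0 i : 'rV[R]_r.
have Uu : U^T *m u^T = 0 by rewrite -trmx_mul uU trmx0.
have PP : P *m P + e^T *m e = 1%:M.
  rewrite trmx_delta mul_delta_mx mulmx_diag; apply/matrixP => a b.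
  rewrite !mxE; have [->|ab] := eqVneq a b.
    by rewrite !mulr1n andbb; case: eqP => _ /=; rewrite ?mul0r ?mulr1 ?addr0 ?add0r.
  rewrite !mulr0n add0r; case: andP => // -[/eqP ai /eqP bi].
  by rewrite ai bi eqxx in ab.
exists (U *m P + u^T *m e); split.
- rewrite /orthonormal_cols [(_ + _)^T]linearD /= !trmx_mul trmxK tr_diag_mx -/P.
  rewrite mulmxDl !mulmxDr -!mulmxA (mulmxA U^T U) UU mul1mx (mulmxA U^T) Uu.
  by rewrite (mulmxA u U) uU (mulmxA u) uu mul1mx !mul0mx !mulmx0 addr0 add0r.
- rewrite -row_mul mulmxDr !mulmxA UU mul1mx Uu mul0mx addr0.
  by apply/rowP => j; rewrite !mxE eqxx mul0rn.
rewrite mulmxDl -!mulmxA mulmx_diag.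
have -> : e *m diag_mx d = 0.
  apply/rowP => j; rewrite mul_mx_diag !mxE.
  by have [->|_] := eqVneq j i; rewrite ?di ?mulr0 ?andbF ?mul0r.
rewrite mulmx0 addr0; congr (_ *m diag_mx _); apply/rowP => j; rewrite !mxE.
by have [->|_] := eqVneq j i; rewrite ?di ?mulr0 ?mul1r.
Qed.

(** Removing the [i]-th singular triple moves [X] by [d_i] only, and after
that the normal bound applies to a frame not containing [u_i]; so row [i] of
[U^T G(X) (1 - V V^T)] is bounded by [L d_i] up to [eps], and the former part
can be divided by [d_i]. *)
Lemma tangent_decomposition_svd (U : 'M[R]_(m, r)) (d : 'rV[R]_r)
    (V : 'M[R]_(n, r)) :
  0 <= L -> 0 <= eps -> (r < m)%N -> orthonormal_cols U -> orthonormal_cols V ->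
  let X := U *m diag_mx d *m V^T in
  exists (N : 'M[R]_n) (E : 'M[R]_(m, n)),
  [/\ G X *m (1%:M - V *m V^T) = X *m N + E,
      frob N <= Num.sqrt r%:R * L & frob E <= (1 + Num.sqrt r%:R) * eps].
Proof.
move=> L0 eps0 rm UU VV X; set Q := 1%:M - V *m V^T.
have [u uU uu] : exists2 u : 'rV[R]_m, u *m U = 0 & u *m u^T = 1%:M.
  by apply: unit_kernel; apply: leq_ltn_trans rm; exact: rank_leq_col.
pose d0 i : 'rV[R]_r := \row_j (d 0 j * (j != i)%:R).
pose X0 i := U *m diag_mx (d0 i) *m V^T.
have XX0 i : frob (X - X0 i) = `|d 0 i|.
  rewrite -mulmxBl -mulmxBr -raddfB /= frob_orthor // frob_orthol //.
  have -> : d - d0 i = d 0 i *: delta_mx 0 i.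
    apply/rowP => j; rewrite !mxE; have [->|_] /= := eqVneq j i.
      by rewrite mulr0 subr0 mulr1.
    by rewrite mulr1 subrr mulr0.
  have -> : diag_mx (d 0 i *: delta_mx 0 i) = d 0 i *: delta_mx i i.
    rewrite linearZ; congr (_ *: _); apply/matrixP => a b; rewrite !mxE eqxx /=.
    have [->|ab] := eqVneq a b; first by rewrite andbb.
    rewrite mulr0n; case: andP => // -[/eqP ai /eqP bi].
    by rewrite ai bi eqxx in ab.
  rewrite frobZ.
  suff -> : frob (delta_mx i i : 'M[R]_r) = 1 by rewrite mulr1.
  apply/eqP; rewrite -(@eqrXn2 _ 2) ?frob_ge0 // frob_sqr_tr trmx_delta.
  rewrite mul_delta_mx /mxtrace (bigD1 i) //= mxE !eqxx big1 ?addr0 ?expr1n //.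
  by move=> j /negbTE ji; rewrite mxE ji.
pose D := \matrix_i row i (U^T *m (G X - G (X0 i)) *m Q).
pose B := \matrix_i row i (U^T *m G (X0 i) *m Q).
have DK i : row i D = row i (U^T *m (G X - G (X0 i)) *m Q) by exact: rowK.
have BK i : row i B = row i (U^T *m G (X0 i) *m Q) by exact: rowK.
have DB : U^T *m G X *m Q = D + B.
  apply/row_matrixP => i; have -> : row i (D + B) = row i D + row i B.
    by apply/rowP => j; rewrite !mxE.
  rewrite DK BK; have -> : U^T *m G X *m Q =
      U^T *m (G X - G (X0 i)) *m Q + U^T *m G (X0 i) *m Q.
    by rewrite -mulmxDl -mulmxDr subrK.
  by apply/rowP => j; rewrite [LHS]mxE [LHS]mxE [RHS]mxE; congr (_ + _); rewrite [RHS]mxE.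
have Di i : frob (row i D) <= L * `|d 0 i|.
  rewrite DK -XX0; apply: le_trans (Llip _ _); apply: le_trans (frob_row_le _ _) _.
  by apply: le_trans (frob_complr _ VV) _; exact: frob_trmull.
have Bi i : frob (row i B) <= eps.
  have d0i : d0 i 0 i = 0 by rewrite mxE eqxx mulr0.
  have [W [WW UW UdW]] := exchange_column UU uU uu d0i.
  have -> : row i B = row i (U^T *m ((1%:M - W *m W^T) *m G (X0 i) *m Q)).
    rewrite BK !row_mul !mulmxA (mulmxBr (row i U^T)) mulmx1 mulmxA UW.
    by rewrite mul0mx subr0.
  apply: le_trans (frob_row_le _ _) _; apply: le_trans (frob_trmull _ UU) _.
  by rewrite /X0 UdW; exact: normal_bound_diag.
pose M := \matrix_i ((d 0 i)^-1 *: row i D).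
have dM : diag_mx d *m M = D.
  apply/row_matrixP => i; rewrite row_mul row_diag_mx -scalemxAl -rowE rowK scalerA.
  have [di|di] := eqVneq (d 0 i) 0; last by rewrite mulfV // scale1r.
  rewrite di mul0r scale0r; apply/esym/frob_eq0/eqP.
  by rewrite eq_le frob_ge0 andbT; have := Di i; rewrite di normr0 mulr0.
exists (V *m M), ((1%:M - U *m U^T) *m G X *m Q + U *m B); split.
- have -> : X *m (V *m M) = U *m D.
    by rewrite /X -!mulmxA (mulmxA V^T) VV mul1mx dM.
  by rewrite addrCA -mulmxDr -DB !mulmxBl mul1mx !mulmxA subrK.
- rewrite frob_orthol //; apply: frob_rows_le => // i; rewrite rowK frobZ normfV.
  have [->|di] := eqVneq (d 0 i) 0; first by rewrite normr0 invr0 mul0r.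
  by rewrite ler_pdivrMl ?normr_gt0 // mulrC.
apply: le_trans (ler_frobD _ _) _; rewrite mulrDl mul1r; apply: lerD.
  exact: normal_bound_diag.
by rewrite frob_orthol //; exact: frob_rows_le.
Qed.

Lemma orthonormal_mul p q s (V : 'M[R]_(p, q)) (O : 'M[R]_(q, s)) :
  orthonormal_cols V -> orthonormal_cols O -> orthonormal_cols (V *m O).
Proof.
move=> VV OO; rewrite /orthonormal_cols trmx_mul -mulmxA (mulmxA V^T) VV.
by rewrite mul1mx.
Qed.

(** A rank-[r] factor [Q^T] absorbs the part of [G(X)] whose rows lie in its
row space. *)
Lemma local_decomposition (K : 'M[R]_(m, r)) (Q : 'M[R]_(n, r)) :
  0 <= L -> 0 <= eps -> (r < m)%N -> (r <= n)%N -> row_free Q^T ->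
  let X := K *m Q^T in
  exists (H : 'M[R]_(m, r)) (N : 'M[R]_n) (E : 'M[R]_(m, n)),
  [/\ G X = H *m Q^T + X *m N + E, frob (H *m Q^T) <= frob (G X),
      frob N <= Num.sqrt r%:R * L & frob E <= (1 + Num.sqrt r%:R) * eps].
Proof.
move=> L0 eps0 rm rn fQ X.
have [V [sg [W1 [VV _ QE]]]] := svd Q rn.
pose T := W1 *m diag_mx sg.
have QT : Q^T = T *m V^T by rewrite QE !trmx_mul trmxK tr_diag_mx mulmxA.
have uT : T \in unitmx.
  rewrite -row_free_unit /row_free eqn_leq rank_leq_row /=.
  by rewrite -{1}(eqP fQ) QT mxrankM_maxl.
have [U [d [W2 [UU OO KE]]]] := svd (K *m T) (ltnW rm).
have XE : X = U *m diag_mx d *m (V *m W2)^T.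
  by rewrite /X QT mulmxA KE trmx_mul mulmxA.
have OO' := mulmx1C OO.
have [N [E [GE Nle Ele]]] :=
  tangent_decomposition_svd d L0 eps0 rm UU (orthonormal_mul VV OO).
rewrite -XE trmx_mul mulmxA -(mulmxA V) OO' mulmx1 in GE.
exists (G X *m V *m invmx T), N, E; split=> //.
  rewrite -addrA -GE QT mulmxA mulmxKV // -mulmxA -mulmxDr addrC subrK.
  by rewrite mulmx1.
by rewrite QT mulmxA mulmxKV // frob_orthor // frob_mulr.
Qed.

Lemma near_orthonormal_free (V Q : 'M[R]_(n, r)) :
  orthonormal_cols V -> frob (Q - V) < 1 -> row_free Q^T.
Proof.
move=> VV QV; rewrite -kermx_eq0; apply/rowV0P => x /sub_kermxP xQ.
have xV : frob x <= frob x * frob (Q - V).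
  rewrite -[leLHS](frob_orthor _ VV) -frobN -[frob (Q - V)]frob_tr.
  apply: le_trans (ler_frobM _ _).
  by rewrite [(Q - V)^T]linearB /= mulmxBr xQ sub0r.
apply/frob_eq0/eqP; rewrite eq_le frob_ge0 andbT.
have : frob x * (1 - frob (Q - V)) <= 0 by rewrite mulrBr mulr1 subr_le0.
by rewrite pmulr_lle0 // subr_gt0.
Qed.
End LocalDecomposition.

(** * Following the solution by a factored matrix *)

Section Continuation.
Variable R : realType.

Lemma has_derivative_onP m n (a b : R) (f : R -> 'M[R]_(m, n)) (x : R)
    (D : 'M[R]_(m, n)) : has_derivative_on a b f x D ->
  forall e : R, 0 < e -> exists2 d : R, 0 < d & forall y, a <= y <= b ->
    `|y - x| < d -> frob (f y - f x - (y - x) *: D) <= e * `|y - x|.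
Proof.
move=> fD e e0.
pose k : R := Num.sqrt m%:R * Num.sqrt n%:R + 1.
have k0 : 0 < k by rewrite ltr_wpDl // mulr_ge0.
have ek0 : 0 < e / k by rewrite divr_gt0.
have /nbhs_ballP[d /= d0 Hd] := fD _ (nbhsx_ballx D _ ek0).
exists d => // y yab yx; have [->|yxN] := eqVneq y x.
  by rewrite !subrr scale0r subrr frob0 normr0 mulr0.
have yball : ball x d y by rewrite /ball /= distrC.
have yab' : `[a, b]%classic y by rewrite /= in_itv.
have [_ {}Hd] := Hd y yball yxN yab'.
set g := (y - x)^-1 *: (f y - f x) in Hd.
have -> : f y - f x - (y - x) *: D = (y - x) *: (g - D).
  by rewrite scalerBr scalerA mulfV ?scale1r // subr_eq0.
rewrite frobZ mulrC ler_wpM2r // frobC.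
apply: le_trans (frob_entries_le (ltW ek0) _) _.
  by move=> i j; apply: ltW; have := Hd i j; rewrite /ball /= !mxE.
rewrite mulrA mulrCA -[leRHS]mulr1 ler_wpM2l ?(ltW e0) // ler_pdivrMr // mul1r.
by rewrite lerDl.
Qed.

(** Real induction along a gauge: the supremum of the points reached is
itself crossed by one more step. *)
Lemma gauge_induction (P : R -> Prop) (s : R) : 0 <= s -> P 0 ->
  (forall c, 0 <= c <= s -> exists2 d : R, 0 < d & forall x y,
     0 <= x <= c -> c <= y <= s -> c - x < d -> y - c < d -> P x -> P y) ->
  P s.
Proof.
move=> s0 P0 step; pose S := [set x | 0 <= x <= s /\ P x].
have S0 : S 0 by rewrite /S /= lexx s0.
have hS : has_sup S by split; [exists 0 | exists s => x [/andP[]]].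
have c0 : 0 <= sup S by apply: ub_le_sup S0; case: hS.
have cs : sup S <= s by apply: ge_sup; [exists 0 | move=> x [/andP[]]].
have [|d d0 Hd] := step (sup S); first by rewrite c0.
have [x [/andP[x0 xs] Px] xc] := sup_adherent d0 hS.
have xle : x <= sup S by apply: ub_le_sup; [case: hS | rewrite /S /= x0 xs].
pose y := Num.min s (sup S + d / 2).
have cy : sup S <= y by rewrite le_min cs lerDl divr_ge0 // ltW.
have Py : P y.
  apply: (Hd x) => //; rewrite ?x0 // ?cy ?ge_min ?lexx //; first by lra.
  have : y <= sup S + d / 2 by rewrite ge_min lexx orbT.
  lra.
have ySup : y <= sup S.
  apply: ub_le_sup; first by case: hS.
  by split=> //; rewrite (le_trans c0 cy) ge_min lexx.
suff <- : y = s by [].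
move: ySup; rewrite /y; case: (leP s (sup S + d / 2)) => //; lra.
Qed.

Variables (m n r : nat) (f : R -> 'M[R]_(m, n) -> 'M[R]_(m, n)).
Variables (A : R -> 'M[R]_(m, n)) (L B eps s : R) (V0 : 'M[R]_(n, r)).
Hypotheses (L0 : 0 <= L) (eps0 : 0 <= eps) (s0 : 0 <= s).
Hypotheses (rm : (r < m)%N) (rn : (r <= n)%N).
Hypothesis Vorth : orthonormal_cols V0.
Hypothesis fB : forall t X, 0 <= t <= s -> frob (f t X) <= B.
Hypothesis fL : forall t X Z, 0 <= t <= s ->
  frob (f t X - f t Z) <= L * frob (X - Z).
Hypothesis fN : forall t (U : 'M[R]_(m, r)) (S : 'M[R]_r) (V : 'M[R]_(n, r)),
  0 <= t <= s -> rank_factors U S V ->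
  frob ((1%:M - U *m U^T) *m f t (U *m S *m V^T) *m (1%:M - V *m V^T)) <= eps.

Let C := Num.sqrt r%:R * L * (Num.sqrt r%:R + 1).
Let c := (1 + Num.sqrt r%:R) * eps.
Hypothesis Cs : C * s <= 1 / 2.

(** One Euler step for the factors. The time [t] at which the field is
frozen is arbitrary, so a step may end as well as start at the point where the
derivative of [A] is controlled. *)
Lemma euler_step (t h : R) (K : 'M[R]_(m, r)) (Q : 'M[R]_(n, r))
    (A0 At A1 : 'M[R]_(m, n)) :
  0 <= t <= s -> 0 <= h -> frob (Q - V0) <= 1 / 2 ->
  exists (K' : 'M[R]_(m, r)) (Q' : 'M[R]_(n, r)),
    frob (Q' - V0) <= frob (Q - V0) + C * h /\
    frob (A1 - K' *m Q'^T) <= (1 + h * L) * frob (A0 - K *m Q^T)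
      + frob (A1 - A0 - h *: f t At)
      + h * (c + L * frob (At - A0) + h * (B * (Num.sqrt r%:R * L))).
Proof.
move=> ts h0 QV.
have fQ : row_free Q^T by apply: near_orthonormal_free Vorth _; lra.
have [H [N [E [fE Hle Nle Ele]]]] := local_decomposition
  (fun X Z => fL X Z ts) (fun U S V => @fN t U S V ts) K L0 eps0 rm rn fQ.
move: fE; rewrite /=; move XE: (K *m Q^T) => X fE.
exists (K + h *: H), (Q + h *: (N^T *m Q)).
have Qle : frob Q <= Num.sqrt r%:R + 1.
  have -> : Q = V0 + (Q - V0) by rewrite addrC subrK.
  apply: le_trans (ler_frobD _ _) _; apply: lerD; last by lra.
  by rewrite -(frob_orthonormal Vorth) sqrtr_sqr ger0_norm ?frob_ge0.
have rL0 : 0 <= Num.sqrt r%:R * L by rewrite mulr_ge0.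
split.
  rewrite -addrA [h *: _ + _]addrC addrA; apply: le_trans (ler_frobD _ _) _.
  rewrite lerD2l frobZ ger0_norm // mulrC ler_wpM2r //.
  apply: le_trans (ler_frobM _ _) _; rewrite frob_tr.
  by apply: ler_pM => //; exact: frob_ge0.
have -> : A1 - (K + h *: H) *m (Q + h *: (N^T *m Q))^T =
    (A0 - X) + (A1 - A0 - h *: f t At) + h *: (f t At - f t X)
    + h *: E - (h * h) *: (H *m Q^T *m N).
  rewrite [(Q + _)^T]linearD /= trmxZ trmx_mul trmxK.
  rewrite mulmxDl !mulmxDr -!scalemxAl -!scalemxAr !mulmxA XE fE.
  move: (H *m Q^T *m N) (H *m Q^T) (X *m N) => HQN HQ XN.
  by apply/matrixP => i j; rewrite !mxE; ring.
have HN : frob ((h * h) *: (H *m Q^T *m N)) <= h * (h * (B * (Num.sqrt r%:R * L))).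
  rewrite frobZ ger0_norm ?mulr_ge0 // -mulrA !ler_wpM2l //.
  apply: le_trans (ler_frobM _ _) _; apply: ler_pM; rewrite ?frob_ge0 //.
  exact: le_trans Hle (fB _ ts).
have fAX : frob (h *: (f t At - f t X)) <=
    h * (L * (frob (At - A0) + frob (A0 - X))).
  rewrite frobZ ger0_norm // ler_wpM2l //; apply: le_trans (fL _ _ ts) _.
  rewrite ler_wpM2l //; apply: le_trans (ler_frobD _ _).
  by rewrite addrA subrK.
have hE : frob (h *: E) <= h * c by rewrite frobZ ger0_norm // ler_wpM2l.
apply: le_trans (ler_frobD _ _) _; rewrite frobN.
apply: le_trans (lerD (ler_frobD _ _) HN) _.
apply: le_trans (lerD (lerD (ler_frobD _ _) hE) (lexx _)) _.
apply: le_trans (lerD (lerD (lerD (ler_frobD _ _) fAX) (lexx _)) (lexx _)) _.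
lra.
Qed.

Hypothesis dA : forall t, 0 <= t <= s -> forall e : R, 0 < e ->
  exists2 d : R, 0 < d & forall y, 0 <= y <= s ->
    `|y - t| < d -> frob (A y - A t - (y - t) *: f t (A t)) <= e * `|y - t|.
Hypothesis A0V : exists K : 'M[R]_(m, r), A 0 = K *m V0^T.

(** The exact solution stays within the accumulated normal defect of a matrix
[K Q^T] whose right factor has hardly moved from [V0]. The drift [C * t] of the
right factor depends on [L] and [r] only: the singular values of the initial
value do not enter. The error grows along [t exp(L t)], a supersolution of the
error recursion of [euler_step]. *)
Lemma near_low_rank (del : R) : 0 < del ->
  exists (K : 'M[R]_(m, r)) (Q : 'M[R]_(n, r)),
    frob (Q - V0) <= 1 / 2 /\
    frob (A s - K *m Q^T) <= (c + del) * s * expR (L * s).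
Proof.
move=> del0.
pose P t := exists (K : 'M[R]_(m, r)) (Q : 'M[R]_(n, r)),
    frob (Q - V0) <= C * t /\
    frob (A t - K *m Q^T) <= (c + del) * t * expR (L * t).
suff [K [Q [QV AK]]] : P s by exists K, Q; split=> //; exact: le_trans Cs.
apply: gauge_induction => //.
  have [K AK] := A0V; exists K, V0.
  by rewrite AK !subrr !frob0 !mulr0 mul0r.
move=> t ts.
have C0 : 0 <= C by rewrite !mulr_ge0 ?addr_ge0.
have c0 : 0 <= c by rewrite mulr_ge0 ?addr_ge0.
have B0 : 0 <= B := le_trans (frob_ge0 _) (fB 0 ts).
(* [k] collects the factors of the second-order terms of a step of length at
   most twice the gauge. *)
pose k := L * (B + 1) + 2 * (B * (Num.sqrt r%:R * L)).
have k0 : 0 <= k by rewrite addr_ge0 // !mulr_ge0 ?addr_ge0.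
have w0 : 0 < Num.min 1 (del / 2) by rewrite lt_min ltr01 divr_gt0.
have [d1 d10 Hd1] := dA ts w0; set w := Num.min 1 (del / 2) in w0 Hd1.
have w1 : w <= 1 by rewrite ge_min lexx.
have wd : w <= del / 2 by rewrite ge_min lexx orbT.
pose d2 := del / 2 / (k + 1).
have d20 : 0 < d2 by rewrite !divr_gt0 // ltr_wpDl.
have kd2 : d2 * k <= del / 2.
  have : d2 * (k + 1) = del / 2 by rewrite divfK // gt_eqF // ltr_wpDl.
  lra.
exists (Num.min d1 d2); first by rewrite lt_min d10 d20.
move=> x y /andP[x0 xt] /andP[ty ys]; rewrite !lt_min.
move=> /andP[tx1 tx2] /andP[yt1 yt2] [K [Q [QV AK]]].
have [_ ts'] := andP ts.
have x_s : 0 <= x <= s by rewrite x0 (le_trans xt).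
have y_s : 0 <= y <= s by rewrite ys (le_trans x0) // (le_trans xt).
have h0 : 0 <= y - x by lra.
have Qhalf : frob (Q - V0) <= 1 / 2.
  apply: le_trans QV (le_trans _ Cs); rewrite ler_wpM2l //; lra.
have [K' [Q' [QV' AK']]] := euler_step K (A x) (A t) (A y) ts h0 Qhalf.
have Ax : frob (A x - A t - (x - t) *: f t (A t)) <= w * (t - x).
  by have := Hd1 x x_s; rewrite distrC ger0_norm; [apply; lra | lra].
have Ay : frob (A y - A t - (y - t) *: f t (A t)) <= w * (y - t).
  by have := Hd1 y y_s; rewrite ger0_norm; [apply; lra | lra].
have Axy : frob (A y - A x - (y - x) *: f t (A t)) <= w * (y - x).
  have -> : A y - A x - (y - x) *: f t (A t) =
      (A y - A t - (y - t) *: f t (A t)) - (A x - A t - (x - t) *: f t (A t)).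
    by apply/matrixP => i j; rewrite !mxE; ring.
  apply: le_trans (ler_frobD _ _) _; rewrite frobN.
  apply: le_trans (lerD Ay Ax) _; lra.
have Atx : frob (A t - A x) <= d2 * (B + 1).
  have -> : A t - A x =
      - (A x - A t - (x - t) *: f t (A t)) + (t - x) *: f t (A t).
    by apply/matrixP => i j; rewrite !mxE; ring.
  apply: le_trans (ler_frobD _ _) _; rewrite frobN frobZ ger0_norm; last by lra.
  apply: le_trans (lerD Ax (ler_wpM2l _ (fB _ ts))) _; first by lra.
  rewrite mulrC -mulrDr ler_pM //; [lra|rewrite addr_ge0 // ltW //|lra|lra].
have h2 : y - x <= 2 * d2 by lra.
have small : w + (L * frob (A t - A x) + (y - x) * (B * (Num.sqrt r%:R * L))) <= del.
  have q0 : 0 <= B * (Num.sqrt r%:R * L) by rewrite !mulr_ge0.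
  have := ler_wpM2r q0 h2; have := ler_wpM2l L0 Atx.
  move: kd2; rewrite /k; lra.
exists K', Q'; split.
  by apply: le_trans QV' _; have := QV; lra.
apply: le_trans AK' _.
have cd0 : 0 <= c + del by rewrite addr_ge0 // ltW.
set h := y - x in h0 h2 Axy small *.
have exph : (1 + h * L) * expR (L * x) <= expR (L * y).
  have -> : L * y = h * L + L * x by rewrite /h; ring.
  by rewrite expRD ler_wpM2r ?expR_ge0 // expR_ge1Dx.
have exp1 : 1 <= expR (L * y).
  by rewrite -expR0 ler_expR mulr_ge0 //; case/andP: y_s.
have -> : (c + del) * y * expR (L * y) = (c + del) * x * expR (L * y)
    + h * ((c + del) * expR (L * y)) by rewrite /h; ring.
have T1 : (1 + h * L) * frob (A x - K *m Q^T) <= (c + del) * x * expR (L * y).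
  apply: le_trans (ler_wpM2l _ AK) _; first by rewrite addr_ge0 // mulr_ge0.
  by rewrite mulrCA ler_wpM2l // mulr_ge0.
have T2 : h * (c + del) <= h * ((c + del) * expR (L * y)).
  by rewrite ler_wpM2l // ler_peMr.
have := ler_wpM2l h0 small; lra.
Qed.
End Continuation.

(** * The error of one reduced K-L step *)

(** The step multiplies [Z = Y0 + dA] by [U1 U1^T], and the complementary
projection annihilates [Z V0]. If [A1] is close to [K Q^T] with [Q] close to
[V0], then the complement of [K] is controlled by [K Q^T V0], that is by
[A1 V0], which is close to [Z V0]; so no inverse of a small singular value
enters. *)
Lemma projection_error (R : realType) m n r (U1 : 'M[R]_(m, r))
    (V0 Q : 'M[R]_(n, r)) (K : 'M[R]_(m, r)) (Z A1 : 'M[R]_(m, n)) :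
  orthonormal_cols U1 -> orthonormal_cols V0 ->
  (1%:M - U1 *m U1^T) *m Z *m V0 = 0 -> frob (Q - V0) <= 1 / 2 ->
  frob (U1 *m U1^T *m Z - A1) <=
    3 * frob (Z - A1) + 2 * frob (A1 - K *m Q^T).
Proof.
move=> UU VV.
have -> : U1 *m U1^T *m Z - A1 = (Z - A1) - (1%:M - U1 *m U1^T) *m Z.
  by rewrite mulmxBl mul1mx opprB [RHS]addrC addrA subrK.
have contr p (X : 'M[R]_(m, p)) : frob ((1%:M - U1 *m U1^T) *m X) <= frob X.
  exact: frob_compll.
move: (1%:M - U1 *m U1^T) contr => P contr ZV QV.
have tcontr p (X : 'M[R]_(p, n)) : frob (X *m (1%:M - V0 *m V0^T)) <= frob X.
  exact: frob_complr.
have PZ : P *m Z = P *m Z *m (1%:M - V0 *m V0^T).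
  by rewrite mulmxBr mulmx1 mulmxA ZV mul0mx subr0.
have VT : V0^T *m (1%:M - V0 *m V0^T) = 0.
  by rewrite mulmxBr mulmx1 mulmxA VV mul1mx subrr.
move: (1%:M - V0 *m V0^T) tcontr PZ VT => T tcontr PZ VT.
move EE : (A1 - K *m Q^T) => E; move WE : (P *m K) => W.
have PA : P *m A1 = W *m Q^T + P *m E.
  by rewrite -WE -EE -mulmxA -mulmxDr addrC subrK.
have Wle : frob W <= 2 * (frob (Z - A1) + frob E).
  have WV : W = W *m (V0 - Q)^T *m V0 - P *m (Z - A1) *m V0 - P *m E *m V0.
    rewrite [(V0 - Q)^T]linearB /= !mulmxBr !mulmxBl ZV -[W *m V0^T *m V0]mulmxA.
    by rewrite VV mulmx1 sub0r opprK PA mulmxDl addrA subrK addrK.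
  have h1 : frob (W *m (V0 - Q)^T *m V0) <= frob W * (1 / 2).
    apply: le_trans (frob_mulr _ VV) _; apply: le_trans (ler_frobM _ _) _.
    by rewrite frob_tr frobC ler_wpM2l // frob_ge0.
  have h2 := le_trans (frob_mulr (P *m (Z - A1)) VV) (contr _ (Z - A1)).
  have h3 := le_trans (frob_mulr (P *m E) VV) (contr _ E).
  have := ler_frobD (W *m (V0 - Q)^T *m V0 - P *m (Z - A1) *m V0) (- (P *m E *m V0)).
  have := ler_frobD (W *m (V0 - Q)^T *m V0) (- (P *m (Z - A1) *m V0)).
  rewrite -WV !frobN; lra.
have {}PZ : P *m Z = P *m (Z - A1) *m T + P *m E *m T + W *m ((Q - V0)^T *m T).
  rewrite [(Q - V0)^T]linearB /= mulmxBl VT subr0 mulmxA.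
  by rewrite -addrA [P *m E *m T + _]addrC -!mulmxDl -PA -mulmxDr subrK.
have k1 := le_trans (tcontr _ (P *m (Z - A1))) (contr _ (Z - A1)).
have k2 := le_trans (tcontr _ (P *m E)) (contr _ E).
have k3 : frob (W *m ((Q - V0)^T *m T)) <= frob W * (1 / 2).
  apply: le_trans (ler_frobM _ _) _; rewrite ler_wpM2l ?frob_ge0 //.
  by apply: le_trans (tcontr _ _) _; rewrite frob_tr.
have := ler_frobD (Z - A1) (- (P *m Z)); rewrite frobN {2}PZ.
have := ler_frobD (P *m (Z - A1) *m T + P *m E *m T) (W *m ((Q - V0)^T *m T)).
have := ler_frobD (P *m (Z - A1) *m T) (P *m E *m T).
lra.
Qed.

(** A negative constant would contract a positive distance to a negative one. *)
Lemma lipschitz_constant_ge0 (R : realType) m n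
    (G : 'M[R]_(m, n) -> 'M[R]_(m, n)) (L : R) :
  (0 < m)%N -> (0 < n)%N ->
  (forall X Z, frob (G X - G Z) <= L * frob (X - Z)) -> 0 <= L.
Proof.
move=> m0 n0 GL; pose X : 'M[R]_(m, n) := const_mx 1.
have fX : 0 < frob X.
  rewrite lt_def frob_ge0 andbT; apply/eqP => /frob_eq0.
  move=> /matrixP/(_ (Ordinal m0) (Ordinal n0))/eqP.
  by rewrite !mxE oner_eq0.
have := le_trans (frob_ge0 _) (GL X 0).
by rewrite subr0 pmulr_lge0.
Qed.

(** This turns the defect [(1 + sqrt r) eps] of the local decomposition into
the constant of the theorem. *)
Lemma one_sqrt_le (R : realType) (m n r : nat) :
  (1 <= r)%N -> (r < minn m n)%N ->
  1 + Num.sqrt r%:R <= Num.sqrt (m * n)%:R :> R.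
Proof.
rewrite leq_min => r1 /andP[rm rn].
have r1' : 1 <= r%:R :> R by rewrite ler1n.
apply: (@le_trans _ _ (r.+1)%:R).
  rewrite -natr1 addrC lerD2r -[leRHS]ger0_norm // -sqrtr_sqr ler_wsqrtr //.
  by rewrite expr2 ler_peMr.
rewrite -[leLHS]ger0_norm // -sqrtr_sqr ler_wsqrtr // -natrX ler_nat.
by rewrite -mulnn leq_mul.
Qed.

Unset Implicit Arguments.

Theorem theorem4p3 (R : realType) (m n r : nat) (LF : R) :
  exists2 hstar : R, 0 < hstar &
  forall (T : R) (F : R -> 'M[R]_(m, n) -> 'M[R]_(m, n)) (B eps : R),
  standing_assumptions r T F B LF eps ->
  forall (s t0 : R), 0 <= s <= hstar -> 0 <= t0 <= T - s ->
  forall (U0 : 'M[R]_(m, r)) (S0 : 'M[R]_r) (V0 : 'M[R]_(n, r))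
    (Y0 : 'M[R]_(m, n)) (A : R -> 'M[R]_(m, n)),
  rank_factors U0 S0 V0 ->
  Y0 = U0 *m S0 *m V0^T ->
  solves_ivp T F t0 Y0 A ->
  forall (dA : 'M[R]_(m, n))
    (U1 : 'M[R]_(m, r)) (S1 : 'M[R]_r) (V1 : 'M[R]_(n, r))
    (Y1 : 'M[R]_(m, n)),
  KL_step U0 S0 V0 dA U1 S1 V1 ->
  rank_admissible U0 S0 V0 dA ->
  Y1 = U1 *m S1 *m V1^T ->
  frob (Y1 - A s) <= 4 * frob (Y0 + dA - A s)
    + 5 * Num.sqrt (m * n)%:R * eps * s * expR (LF * s).
Proof.
pose C := Num.sqrt r%:R * `|LF| * (Num.sqrt r%:R + 1).
have C0 : 0 <= C by rewrite !mulr_ge0 ?addr_ge0.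
exists (1 / 2 / (C + 1)); first by rewrite !divr_gt0 // ltr_wpDl.
move=> T F B eps [T0 r1 rmn _ Fbd Flip eps0 Fnor] s t0 /andP[s0 sh] /andP[t00 t0T].
move=> U0 S0 V0 Y0 A [UU0 _ VV0] Y0E [A0 Ader] dA U1 S1 V1 Y1.
move=> [UU1 [S1h KE] VV1 LE] _ Y1E.
have [rm rn] : (r < m)%N /\ (r < n)%N by move: rmn; rewrite leq_min => /andP.
have time t : 0 <= t <= s -> 0 <= t0 + t <= T by lra.
have LF0 : 0 <= LF.
  apply: (@lipschitz_constant_ge0 _ m n (F 0)).
  - exact: leq_ltn_trans rm.
  - exact: leq_ltn_trans rn.
  by move=> X Z; apply: Flip; rewrite lexx ltW.
have Cs : Num.sqrt r%:R * LF * (Num.sqrt r%:R + 1) * s <= 1 / 2.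
  have : C * s <= (C + 1) * (1 / 2 / (C + 1)).
    by apply: ler_pM => //; rewrite lerDl.
  by rewrite mulrC [leRHS]mulrC divfK ?gt_eqF ?ltr_wpDl // mulrC /C ger0_norm.
have dAs t : 0 <= t <= s -> forall e : R, 0 < e ->
    exists2 d : R, 0 < d & forall y, 0 <= y <= s -> `|y - t| < d ->
    frob (A y - A t - (y - t) *: F (t0 + t) (A t)) <= e * `|y - t|.
  move=> ts e e0; have [|d d0 Hd] := has_derivative_onP (Ader t _) e0; first by lra.
  by exists d => // y ys; apply: Hd; lra.
have low del := @near_low_rank R m n r (fun t => F (t0 + t)) A LF B eps s V0
  LF0 eps0 s0 rm (ltnW rn) VV0 (fun t X ts => Fbd _ X (time t ts))
  (fun t X Z ts => Flip _ X Z (time t ts))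
  (fun t U S V ts => Fnor _ U S V (time t ts)) Cs dAs
  (ex_intro _ (U0 *m S0) (etrans A0 Y0E)) del.
have Y1Z : Y1 = U1 *m U1^T *m (Y0 + dA).
  rewrite Y1E -[S1]trmxK -mulmxA -trmx_mul LE /L1 linearD /= !trmx_mul !trmxK.
  by rewrite Y0E -[RHS]mulmxA [X in _ = _ *m X]mulmxDr -[U0 *m S0 *m _]mulmxA.
have ZV : (1%:M - U1 *m U1^T) *m (Y0 + dA) *m V0 = 0.
  have -> : (1%:M - U1 *m U1^T) *m (Y0 + dA) *m V0 =
      (1%:M - U1 *m U1^T) *m (U1 *m S1h).
    by rewrite KE -mulmxA /K1 (mulmxDl Y0) Y0E -[_ *m V0^T *m V0]mulmxA VV0 mulmx1.
  by rewrite mulmxA mulmxBl mul1mx -(mulmxA U1) UU1 mulmx1 subrr mul0mx.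
set D := frob (Y0 + dA - A s); set c := Num.sqrt (m * n)%:R.
have c1 : 1 + Num.sqrt r%:R <= c :> R by exact: one_sqrt_le.
set E := s * expR (LF * s).
have E0 : 0 <= E by rewrite mulr_ge0 ?expR_ge0.
have D0 : 0 <= D := frob_ge0 _.
apply/ler_addgt0Pr => e e0.
have [|K [Q [QV AK]]] := low (e / (2 * (E + 1))).
  by rewrite divr_gt0 // mulr_gt0 // ltr_wpDl.
have := @projection_error _ _ _ _ U1 V0 Q K _ (A s) UU1 VV0 ZV QV; rewrite -Y1Z -/D => H.
apply: le_trans H _.
rewrite -mulrA -/E mulrDl in AK.
have cE : (1 + Num.sqrt r%:R) * eps * E <= c * eps * E by rewrite !ler_wpM2r.
have eE : 2 * (e / (2 * (E + 1)) * E) <= e.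
  rewrite [leLHS](_ : _ = e * (E / (E + 1))); last by field; rewrite gt_eqF // ltr_wpDl.
  by rewrite ler_piMr ?(ltW e0) // ler_pdivrMr ?mul1r ?lerDl // ltr_wpDl.
have ceE : 0 <= c * eps * E by rewrite !mulr_ge0 ?sqrtr_ge0.
have -> : 5 * c * eps * s * expR (LF * s) = 5 * (c * eps * E).
  by rewrite /E !mulrA.
lra.
Qed.
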